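(* Suppose that $X=Y^*$ for some real Banach lattice $Y$, and $\mathcal C$ is a collection of positive adjoint operators on $X$. If $\mathcal C$ is finitely quasinilpotent at some $x_0>0$ in $X$, then there exist non-zero $x\in X_+$ and non-zero $f\in X^*_+$ such that $\langle f,Tx\rangle\le\theta(T_* )$ for all $T\in\mathcal E_{\mathcal C}$.
   Context: $L(Z)$ denotes the space of bounded linear operators on a Banach space $Z$. $X=Y^*$ is the dual Banach lattice of $Y$. $X_+$, $X^*_+$, $L(X)_+$ denote the cones of positive elements of $X$, $X^*$, $L(X)$ (an operator $T\in L(X)$ is positive if $T(X_+)\subseteq X_+$; $S\le T$ means $T-S\in L(X)_+$); $x_0>0$ means $x_0\in X_+$, $x_0\neq0$. An operator $T\in L(X)$ is called adjoint (with respect to $Y$) if $T=S^*$ for some $S\in L(Y)$; this $S$ is unique and is denoted $T_*$. An operator on a Banach lattice is AM-compact if the image of every order interval under it is relatively compact (in norm). For $T\in L(Y)$ define $\theta(T)=\inf\{\lVert T-K\rVert : K\in L(Y)\text{ is AM-compact}\}$. For collections $\mathcal C,\mathcal D$ of operators, $\mathcal C\mathcal D=\{TS: T\in\mathcal C,\ S\in\mathcal D\}$, and $\mathcal C^n$ is the product of $n$ copies of $\mathcal C$. For a subset $U\subseteq X$, $\lVert U\rVert=\sup\{\lVert x\rVert: x\in U\}$. A collection $\mathcal C$ of operators is finitely quasinilpotent at $x\in X$ if $\limsup_n\lVert\mathcal F^nx\rVert^{1/n}=0$ for every finite subcollection $\mathcal F$ of $\mathcal C$, where $\mathcal F^nx=\{Tx:T\in\mathcal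 F^n\}$. The super right commutant of $\mathcal C$ is $[\mathcal C\rangle=\{S\in L(X)_+ : ST\ge TS\text{ for each }T\in\mathcal C\}$. Define $$\mathcal D_{\mathcal C}=\Bigl\{D\in L(X)_+ : \exists\, k\ge 1,\ T_1,\dots,T_k\in[\mathcal C\rangle,\ S_1,\dots,S_k\in\bigcup_{n=1}^\infty\mathcal C^n\text{ such that }D\le\sum_{i=1}^kT_iS_i\Bigr\}$$ and $$\mathcal E_{\mathcal C}=\{T\in\mathcal D_{\mathcal C} : T=S^*\text{ for some }S\in L(Y)\}.$$ *)

(* Defs.v *)
From HB Require Import structures.
From mathcomp Require Import all_boot all_order all_algebra.
From mathcomp Require Import all_classical all_reals all_analysis.

Set Implicit Arguments.
Unset Strict Implicit.
Unset Printing Implicit Defensive.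

Import Order.TTheory GRing.Theory Num.Theory.
Import numFieldNormedType.Exports.

Local Open Scope classical_set_scope.
Local Open Scope ring_scope.

(** * Banach lattices *)

(* The order is a field of its own, written [x <=v y]: the hierarchy has no
   join of [Order.Preorder] and [Num.SemiNormedZmodule] below [numDomainType],
   and one cannot be added after the fact. *)
HB.mixin Record NormedModule_isOrdered (R : realType) V
    of NormedModule R V := {
  vle : V -> V -> Prop;
  vle_refl : forall x, vle x x;
  vle_anti : forall x y, vle x y -> vle y x -> x = y;
  vle_trans : forall y x z, vle x y -> vle y z -> vle x z;
  vleD2r : forall z x y, vle x y -> vle (x + z) (y + z);
  vleZ : forall (a : R) x y, 0 <= a -> vle x y -> vle (a *: x) (a *: y)
}.

#[short(type="orderedNormedModType")]
HB.structure Definition OrderedNormedModule (R : realType) :=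
  {V of NormedModule R V & NormedModule_isOrdered R V}.

Notation "x <=v y" := (vle x y) (at level 70, no associativity) : ring_scope.

(* [vmod] is the modulus [x \/ -x], as opposed to the norm [`|x|]. *)
HB.mixin Record OrderedNormedModule_isBanachLattice (R : realType) V
    of OrderedNormedModule R V & CompleteNormedModule R V := {
  vjoin : V -> V -> V;
  vmeet : V -> V -> V;
  vjoinP : forall x y z : V, vjoin x y <=v z <-> x <=v z /\ y <=v z;
  vmeetP : forall x y z : V, z <=v vmeet x y <-> z <=v x /\ z <=v y;
  lattice_norm : let vmod x := vjoin x (- x) in
    forall x y : V, vmod x <=v vmod y -> `|x| <= `|y|
}.

#[short(type="banachLatticeType")]
HB.structure Definition BanachLattice (R : realType) :=
  {V of OrderedNormedModule R V & CompleteNormedModule R V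
   & OrderedNormedModule_isBanachLattice R V}.

(** * Bounded linear operators *)

Section BoundedLinear.
Context {R : realType}.
Implicit Types U V W : normedModType R.

Definition bounded_linear V W : {pred V -> W} :=
  fun f => `[< linear f /\ exists M : R, forall x, `|f x| <= M * `|x| >].

Lemma bounded_linear_submod V W : submod_closed (@bounded_linear V W).
Proof.
split=> [|a f g /asboolP[lf [M fM]] /asboolP[lg [N gN]]]; apply/asboolP; split.
- by move=> a x y /=; rewrite scaler0 addr0.
- by exists 0 => x; rewrite normr0 mul0r.
- move=> b x y; rewrite !fctE lf lg !scalerDr !scalerA (mulrC b).
  by rewrite -!addrA; congr (_ + _); rewrite addrCA.
- exists (`|a| * M + N) => x; rewrite !fctE (le_trans (ler_normD _ _))//.
  by rewrite mulrDl lerD// normrZ -mulrA ler_wpM2l.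
Qed.

HB.instance Definition _ V W :=
  GRing.isSubmodClosed.Build R (V -> W) (@bounded_linear V W)
    (@bounded_linear_submod V W).

Record blin V W := BLin {
  blin_fun :> V -> W;
  blinP : blin_fun \in @bounded_linear V W }.

HB.instance Definition _ V W := [isSub for @blin_fun V W].
HB.instance Definition _ V W := gen_eqMixin (blin V W).
HB.instance Definition _ V W := gen_choiceMixin (blin V W).
HB.instance Definition _ V W := [SubChoice_isSubLmodule of blin V W by <:].

Lemma blin_linear V W (f : blin V W) : linear f.
Proof. by have /asboolP[] := blinP f. Qed.

HB.instance Definition _ V W (f : blin V W) :=
  GRing.isLinear.Build R V W *:%R f (blin_linear f).

Definition opnorm V W (f : blin V W) : R :=
  sup [set `|f x| | x in [set x | `|x| <= 1]].

Section opnorm.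
Variables V W : normedModType R.
Implicit Types f g : blin V W.

Let ball_img f := [set `|f x| | x in [set x | `|x| <= 1]].

Let ball_img_has_sup f : has_sup (ball_img f).
Proof.
have /asboolP[_ [M fM]] := blinP f; split.
  by exists `|f 0|, 0 => //=; rewrite normr0.
exists `|M| => _ [x /= x1 <-]; apply: (le_trans (fM x)).
apply: (le_trans (ler_norm _)); rewrite normrM normr_id.
by rewrite ler_piMr.
Qed.

Lemma opnorm_ub f x : `|x| <= 1 -> `|f x| <= opnorm f.
Proof. by move=> x1; apply: (sup_upper_bound (ball_img_has_sup f)); exists x. Qed.

Lemma opnorm_ge0 f : 0 <= opnorm f.
Proof. by apply: le_trans (@opnorm_ub f 0 _) => //; rewrite normr0. Qed.

Lemma opnorm_le f M : (forall x, `|x| <= 1 -> `|f x| <= M) -> opnorm f <= M.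
Proof.
move=> fM; apply: ge_sup; first by case: (ball_img_has_sup f).
by move=> _ [x /= x1 <-]; exact: fM.
Qed.

Lemma opnormP f x : `|f x| <= opnorm f * `|x|.
Proof.
have [->|x0] := eqVneq x 0; first by rewrite linear0 !normr0 mulr0.
have nx : 0 < `|x| by rewrite normr_gt0.
rewrite -ler_pdivrMr// mulrC.
rewrite -[`|x|^-1]ger0_norm ?invr_ge0// -normrZ -linearZ; apply: opnorm_ub.
by rewrite normrZ normfV normr_id mulVf// gt_eqF.
Qed.

Lemma opnormD f g : opnorm (f + g) <= opnorm f + opnorm g.
Proof.
apply: opnorm_le => x x1.
by rewrite (le_trans (ler_normD _ _))// lerD// opnorm_ub.
Qed.

Lemma opnormZ a f : opnorm (a *: f) = `|a| * opnorm f.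
Proof.
have le b g : opnorm (b *: g) <= `|b| * opnorm g.
  by apply: opnorm_le => x x1; rewrite normrZ ler_wpM2l// opnorm_ub.
have [->|a0] := eqVneq a 0.
  rewrite normr0 mul0r; apply/eqP; rewrite eq_le opnorm_ge0 andbT.
  by apply: (le_trans (le _ _)); rewrite normr0 mul0r.
apply/eqP; rewrite eq_le le /= -ler_pdivlMl ?normr_gt0// -normfV.
by rewrite -{1}[f](scalerK a0) le.
Qed.

Lemma opnorm0_eq0 f : opnorm f = 0 -> f = 0.
Proof.
move=> f0; apply: val_inj; apply/funext => x /=; apply/eqP.
by rewrite -normr_le0 (le_trans (opnormP f x))// f0 mul0r.
Qed.

HB.instance Definition _ :=
  Lmodule_isNormed.Build R (blin V W) opnormD opnormZ opnorm0_eq0.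

End opnorm.

Lemma idfun_bounded_linear V : (idfun : V -> V) \in @bounded_linear V V.
Proof. by apply/asboolP; split=> //; exists 1 => x; rewrite mul1r. Qed.

Definition blin_id V : blin V V := BLin (idfun_bounded_linear V).

Lemma comp_bounded_linear U V W (T : blin V W) (S : blin U V) :
  (T \o S) \in @bounded_linear U W.
Proof.
apply/asboolP; split; first by move=> a x y /=; rewrite !linearP.
exists (opnorm T * opnorm S) => x /=; apply: (le_trans (opnormP T _)).
by rewrite -mulrA ler_wpM2l ?opnorm_ge0 ?opnormP.
Qed.

Definition blin_comp U V W (T : blin V W) (S : blin U V) : blin U W :=
  BLin (comp_bounded_linear T S).

End BoundedLinear.

Notation "T \oL S" := (blin_comp T S)
  (at level 40, left associativity) : ring_scope.
Notation "''L' ( Z )" := (blin Z Z) (at level 8, format "''L' ( Z )") : type_scope.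

(** * Duals *)

(* Only the norm and the order of the dual Banach lattice are set up here; they
   determine its lattice operations. *)
Definition dual (R : realType) (V : normedModType R) := blin V R^o.

HB.instance Definition _ (R : realType) (V : normedModType R) :=
  NormedModule.copy (dual V) (blin V R^o).

Section DualOrder.
Context {R : realType} (Y : banachLatticeType R).
Implicit Types f g h : dual Y.

Definition dual_le f g := forall y : Y, 0 <=v y -> (f y : R) <= g y.

Let dual_le_refl f : dual_le f f.
Proof. by move=> y _. Qed.

Let dual_le_anti f g : dual_le f g -> dual_le g f -> f = g.
Proof.
move=> fg gf; have E y : 0 <=v y -> f y = g y.
  by move=> y0; apply/eqP; rewrite eq_le fg ?gf.
apply: val_inj; apply/funext => y /=.
have [yj zj] : y <=v vjoin y 0 /\ 0 <=v vjoin y 0.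
  by apply/vjoinP; exact: vle_refl.
have z0 : 0 <=v vjoin y 0 - y by have := vleD2r (- y) _ _ yj; rewrite subrr.
have -> : y = vjoin y 0 - (vjoin y 0 - y) by rewrite opprB addrC subrK.
have B h u v : h (u - v) = h u - h v by exact: linearB.
by rewrite (B f) (B g) (E _ zj) (E _ z0).
Qed.

Let dual_le_trans g f h : dual_le f g -> dual_le g h -> dual_le f h.
Proof. by move=> fg gh y y0; rewrite (le_trans (fg _ y0))// gh. Qed.

Let dual_leD2r h f g : dual_le f g -> dual_le (f + h) (g + h).
Proof. by move=> fg y y0; rewrite lerD2r fg. Qed.

Let dual_leZ (a : R) f g : 0 <= a -> dual_le f g -> dual_le (a *: f) (a *: g).
Proof. by move=> a0 fg y y0; rewrite ler_wpM2l ?fg. Qed.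

HB.instance Definition _ := NormedModule_isOrdered.Build R (dual Y)
  dual_le_refl dual_le_anti dual_le_trans dual_leD2r dual_leZ.

End DualOrder.

Section Adjoint.
Context {R : realType} {V : normedModType R}.

Lemma adjoint_bounded_linear (S : 'L(V)) :
  (fun f : dual V => f \oL S : dual V) \in @bounded_linear R (dual V) (dual V).
Proof.
apply/asboolP; split; first by move=> a f g; exact: val_inj.
exists (opnorm S) => f; apply: opnorm_le => x x1 /=.
apply: (le_trans (opnormP f _)); rewrite mulrC ler_wpM2r ?opnorm_ge0//.
exact: opnorm_ub.
Qed.

Definition adjoint (S : 'L(V)) : 'L(dual V) := BLin (adjoint_bounded_linear S).

Definition is_adjoint (T : 'L(dual V)) := exists S : 'L(V), T = adjoint S.

(* [T_*], for [T = S^*]: such an [S] is unique by the Hahn-Banach theorem. The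
   value is [0] when [T] is not an adjoint. *)
Definition preadjoint (T : 'L(dual V)) : 'L(V) :=
  xget 0 [set S | T = adjoint S].

End Adjoint.

(** * Positive operators *)

Section Positive.
Context {R : realType}.

Definition positive_op (Z : orderedNormedModType R) (T : 'L(Z)) :=
  forall x : Z, 0 <=v x -> 0 <=v T x.

Definition op_le (Z : orderedNormedModType R) (S T : 'L(Z)) :=
  positive_op (T - S).

Definition positive_functional (Z : orderedNormedModType R) (f : dual Z) :=
  forall x : Z, 0 <=v x -> 0 <= (f x : R).

Definition order_interval (Z : orderedNormedModType R) (a b : Z) :=
  [set z | a <=v z /\ z <=v b].

Definition AM_compact (Z : orderedNormedModType R) (K : 'L(Z)) :=
  forall a b : Z, precompact [set K z | z in order_interval a b].

Definition theta (Y : orderedNormedModType R) (T : 'L(Y)) : R :=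
  inf [set `|T - K| | K in @AM_compact Y].

End Positive.

(** * Collections of operators *)

Section Collections.
Context {R : realType}.

Definition op_mul (Z : normedModType R) (C D : set 'L(Z)) : set 'L(Z) :=
  [set T \oL S | T in C & S in D].

(* [C^n], with [C^0] reduced to the identity so that [C^1 = C] *)
Definition op_exp (Z : normedModType R) (C : set 'L(Z)) (n : nat) : set 'L(Z) :=
  iter n (op_mul C) [set blin_id Z].

(* This is a supremum in [R], thus [0] for the empty set; it is only used for
   the finite sets [op_exp F n] applied to a vector. *)
Definition set_norm (Z : normedModType R) (U : set Z) : R :=
  sup [set `|x| | x in U].

Definition finitely_quasinilpotent_at (Z : normedModType R) (C : set 'L(Z))
    (x : Z) :=
  forall F : set 'L(Z), F `<=` C -> finite_set F ->
    limn_esup (fun n : nat =>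
      (set_norm [set T x | T in op_exp F n] `^ (n%:R)^-1)%:E) = 0%E.

Context {X : orderedNormedModType R}.
Implicit Types C : set 'L(X).

Definition super_right_commutant C : set 'L(X) :=
  [set S | positive_op S /\ forall T, C T -> op_le (T \oL S) (S \oL T)].

Definition op_semigroup C : set 'L(X) :=
  \bigcup_(n in [set n | (1 <= n)%N]) op_exp C n.

Definition D_ C : set 'L(X) :=
  [set D | positive_op D /\
     exists k : nat, (1 <= k)%N /\ exists T S : 'I_k -> 'L(X),
       [/\ forall i, super_right_commutant C (T i),
           forall i, op_semigroup C (S i) &
           op_le D (\sum_(i < k) T i \oL S i)]].

End Collections.

Definition E_ (R : realType) (Y : banachLatticeType R)
    (C : set 'L(dual Y)) : set 'L(dual Y) :=
  D_ C `&` [set T | is_adjoint T].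

(* Main.v *)
Require Import Defs.
From HB Require Import structures.
From mathcomp Require Import all_boot all_order all_algebra.
From mathcomp Require Import all_classical all_reals all_analysis.
From mathcomp Require Import ring lra.

Set Implicit Arguments.
Unset Strict Implicit.
Unset Printing Implicit Defensive.

Import Order.TTheory GRing.Theory Num.Theory.
Import numFieldNormedType.Exports.

Local Open Scope classical_set_scope.
Local Open Scope ring_scope.

(** Write X for the dual of Y, let [y0 >= 0] satisfy [x0 y0 > 0], put
    [c = x0 y0 / 2], and let B be the set of functionals [w] with
    [0 <= w <= x0] and [w y0 >= c]. It is weak-star compact
    ([compact_functional_interval]) and does not contain 0.

    The argument is a dichotomy at each [x] in B. On X, let [P z] be the infimum
    of [|S - K| + |e|] over the decompositions [z <= S^* x + e] with [S^*]
    dominated as in the definition of [D_ C] and [K] AM-compact. This [P] is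
    sublinear. If [P x0 > 0] for one [x] in B, the Hahn-Banach theorem gives a
    linear [f <= P] with [f x0 > 0]. Such an [f] is bounded since [P z <= |z|],
    positive since [P z <= 0] for [z <= 0], and satisfies
    [f (S^* x) <= |S - K|] for every [K], hence the required inequality
    ([separation_alternative]).

    Otherwise every [x] in B has some [S] close to an AM-compact [K] such that
    [x0 <= S^* x] up to a small error. The set [K `[0, y0]`] being relatively
    compact, [w |-> w \o K] is continuous from the weak-star topology of B to
    uniform convergence on the order interval from 0 to [y0]; so
    [S^* w >= x0 - c] on that interval for all [w] in B close to [x]
    ([adjoint_lb_near]). By the Riesz-Kantorovich formula the meet of [x0] and
    [S^* w] then has value at least [c] at [y0], so some element of B lies below
    [S^* w] ([dual_meet_lb], [interval_step]). By compactness finitely many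
    operators [S_1^*, ..., S_m^*] suffice for all of B
    ([compact_finite_choice]), and iteration from [x0] yields a sequence in B
    with [z_(n+1) <= S_(i_n)^* z_n].

    Such a sequence cannot exist. Each [S_i^*] is dominated by a finite sum of
    products [A * T] with [A] in the super right commutant and [T] a word in C,
    and [T A <= A T] lets all the words be moved to the right. So [z_n] is
    dominated by at most [k^n] terms [A T x0], where [|A| <= M^n] and [T] is a
    word of length at least [n] in a fixed finite part of C
    ([iterates_dominated]). Quasinilpotence at [x0] beats the factor [(k M)^n]
    ([iterates_vanish]), whereas [z_n y0 >= c]. *)

(** * The Hahn-Banach theorem in conic form *)

Section HahnBanach.
Context {R : realType} {V : lmodType R}.
Implicit Types (A : set (V * R)) (v x y : V) (m r s t : R).

(** A convex cone in [V * R] encodes the sublinear functional sending [x] to the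
    infimum of the [r] with [A (x, r)]; the last two clauses make this infimum
    finite. Maximality arguments are easier on cones, ordered by inclusion, than
    on functionals. *)
Definition epi_cone A := [/\
  forall x y r s, A (x, r) -> A (y, s) -> A (x + y, r + s),
  forall t x r, 0 <= t -> A (x, r) -> A (t *: x, t * r),
  forall x, exists r, A (x, r) &
  forall r, A (0, r) -> 0 <= r].

(** The cone generated by [A] and the ray through [(- v, - m)]: adding it forces
    any linear functional below the cone to be at least [m] at [v]. *)
Definition cone_adjoin A v m : set (V * R) :=
  [set p | exists2 t, 0 <= t & A (p.1 + t *: v, p.2 + t * m)].

Lemma epi_cone00 A : epi_cone A -> A (0, 0).
Proof.
move=> [_ sA tA _]; have [r Ar] := tA 0.
by have := sA 0 _ _ (lexx 0) Ar; rewrite scaler0 mul0r.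
Qed.

Lemma sub_cone_adjoin A v m : A `<=` cone_adjoin A v m.
Proof. by move=> [x r] Ax; exists 0; rewrite //= scale0r mul0r !addr0. Qed.

Lemma cone_adjoinN A v m : epi_cone A -> cone_adjoin A v m (- v, - m).
Proof.
move=> /epi_cone00 A0; exists 1 => //=.
by rewrite scale1r mul1r !addNr.
Qed.

Lemma epi_cone_adjoin A v m : epi_cone A ->
  (forall r, A (v, r) -> m <= r) -> epi_cone (cone_adjoin A v m).
Proof.
move=> [dA sA tA pA] mA; split.
- move=> x y r s [t t0 /= Ax] [u u0 /= Ay]; exists (t + u); first exact: addr_ge0.
  by rewrite /= scalerDl mulrDl addrACA (addrACA r); exact: dA.
- move=> t x r t0 [u u0 /= Ax]; exists (t * u); first exact: mulr_ge0.
  by rewrite /= -scalerA -mulrA -scalerDr -mulrDr; exact: sA.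
- by move=> x; have [r Ar] := tA x; exists r; exact: sub_cone_adjoin.
- move=> r [t t0 /=]; rewrite add0r => Ar.
  have [t00|tn0] := eqVneq t 0.
    by move: Ar; rewrite t00 scale0r mul0r addr0; exact: pA.
  have tp : 0 < t by rewrite lt0r tn0.
  have /mA : A (v, t^-1 * (r + t * m)).
    by rewrite -[v](scalerK tn0); apply: sA => //; rewrite invr_ge0.
  by rewrite mulrDr mulKf// lerDr pmulr_rge0// invr_gt0.
Qed.

(** Zorn's lemma is applied to the [B] such that [A `|` B] is a cone, so that the
    union of the empty chain still corresponds to [A]. *)
Lemma ex_maximal_epi_cone A : epi_cone A -> exists M,
  [/\ epi_cone M, A `<=` M & forall N, epi_cone N -> M `<=` N -> N `<=` M].
Proof.
move=> coneA.
have chain (F : set (set (V * R))) :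
    F `<=` [set B | epi_cone (A `|` B)] -> total_on F subset ->
    epi_cone (A `|` \bigcup_(B in F) B).
  move=> FP Ftot.
  have [->|/set0P[B0 FB0]] := eqVneq F set0.
    by rewrite bigcup_set0 setU0.
  have up p : (A `|` \bigcup_(B in F) B) p -> exists2 B, F B & (A `|` B) p.
    by move=> [Ap|[B FB Bp]]; [exists B0 => //; left|exists B => //; right].
  have down B : F B -> A `|` B `<=` A `|` \bigcup_(B in F) B.
    by move=> FB; apply: setUS; exact: bigcup_sup.
  split.
  - move=> x y r s /up[B FB Bx] /up[D FD Dy].
    have [BD|DB] := Ftot _ _ FB FD.
      have [dD _ _ _] := FP _ FD.
      by apply: (down _ FD); apply: dD => //; exact: setUS Bx.
    have [dB _ _ _] := FP _ FB.
    by apply: (down _ FB); apply: dB => //; exact: setUS Dy.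
  - move=> t x r t0 /up[B FB Bx]; have [_ sB _ _] := FP _ FB.
    by apply: (down _ FB); exact: sB.
  - move=> x; have [_ _ tB _] := FP _ FB0; have [r Br] := tB x.
    by exists r; exact: down Br.
  - by move=> r /up[B FB Br]; have [_ _ _ pB] := FP _ FB; exact: pB.
have [B [coneB maxB]] := Zorn_bigcup chain.
exists (A `|` B); split => [//||N coneN BN]; first exact: subsetUl.
have BN' : B `<=` N by move=> p Bp; apply: BN; right.
apply: contrapT => nNB; apply: (maxB N).
  by split=> // NB; apply: nNB => p /NB Bp; right.
by rewrite /= (_ : A `|` N = N)//; apply/setUidPr => p Ap; apply: BN; left.
Qed.

(** In a maximal cone [M] the infimum [f] of the fibres is linear: the ray through
    [(- x, - f x)] can be adjoined to [M], hence already lies in it, and [M]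
    contains the whole graph of [f] together with its opposite. Adjoining the ray
    through [(- v0, - m0)] beforehand controls [f] from below at [v0]. *)
Theorem hahn_banach A v0 m0 : epi_cone A ->
  (forall r, A (v0, r) -> m0 <= r) ->
  exists f : V -> R, [/\ linear (f : V -> R^o),
    forall x r, A (x, r) -> f x <= r & m0 <= f v0].
Proof.
move=> coneA mA.
have [M [coneM AM maxM]] := ex_maximal_epi_cone (epi_cone_adjoin coneA mA).
have [dM sM tM pM] := coneM.
have opp_lb x s : M (- x, s) -> forall r, M (x, r) -> - s <= r.
  move=> Ms r Mr; rewrite -subr_ge0 opprK; apply: pM.
  by rewrite -(subrr x); exact: dM.
pose f x := inf [set r | M (x, r)].
have hasinf x : has_inf [set r | M (x, r)].
  split; first exact: tM.
  by have [s Ms] := tM (- x); exists (- s) => r; exact: opp_lb.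
have f_le x r : M (x, r) -> f x <= r.
  by move=> Mr; apply: ge_inf => //; case: (hasinf x).
have MN x : M (- x, - f x).
  apply: (maxM (cone_adjoin M x (f x))).
  - by apply: epi_cone_adjoin => // r; exact: f_le.
  - exact: sub_cone_adjoin.
  - exact: cone_adjoinN.
have fN x : f (- x) = - f x.
  apply/eqP; rewrite eq_le f_le//= lerNl.
  apply: lb_le_inf; first exact: tM.
  move=> r Mr; rewrite lerNl; apply: lb_le_inf; first exact: tM.
  by move=> s Ms; rewrite lerNl; exact: opp_lb Mr.
have Mf x : M (x, f x) by rewrite -[x]opprK fN; exact: MN.
have f_eq x r : M (x, r) -> M (- x, - r) -> f x = r.
  by move=> /f_le fx /f_le; rewrite fN lerN2 => xf; apply/eqP; rewrite eq_le fx.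
have MZ a x : M (a *: x, a * f x).
  have [a0|/ltW a0] := leP 0 a; first exact: sM.
  by rewrite -[a]opprK scaleNr -scalerN mulNr -mulrN; apply: sM; rewrite ?oppr_ge0.
exists f; split.
- move=> a x y; apply: f_eq; first exact: dM.
  rewrite !opprD; apply: dM => //.
  by rewrite -scaleNr -[- (a *: _)]mulNr; exact: MZ.
- move=> x r Ax; apply/f_le/AM; exact: sub_cone_adjoin.
- rewrite -lerN2 -fN; apply/f_le/AM; exact: cone_adjoinN.
Qed.

End HahnBanach.

(** * Ordered normed spaces and positive functionals *)

Section OrderedSpace.
Context {R : realType} {Z : orderedNormedModType R}.
Implicit Types x y z : Z.

Lemma vleD x y z w : x <=v y -> z <=v w -> x + z <=v y + w.
Proof.
move=> xy zw; apply: (vle_trans _ _ _ (vleD2r z _ _ xy)).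
by rewrite ![y + _]addrC; exact: vleD2r.
Qed.

Lemma vsub_ge0 x y : 0 <=v y - x <-> x <=v y.
Proof.
split=> [xy|xy]; last by have := vleD2r (- x) _ _ xy; rewrite subrr.
by have := vleD2r x _ _ xy; rewrite add0r subrK.
Qed.

Lemma vaddr_ge0 x y : 0 <=v x -> 0 <=v y -> 0 <=v x + y.
Proof. by move=> x0 y0; have := vleD x0 y0; rewrite addr0. Qed.

Lemma vscale_ge0 (a : R) x : 0 <= a -> 0 <=v x -> 0 <=v a *: x.
Proof. by move=> a0 x0; have := vleZ _ _ _ a0 x0; rewrite scaler0. Qed.

Lemma vle_sum (I : eqType) (s : seq I) (f g : I -> Z) :
  (forall i, i \in s -> f i <=v g i) ->
  \sum_(i <- s) f i <=v \sum_(i <- s) g i.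
Proof.
move=> fg; rewrite big_seq [X in _ <=v X]big_seq.
elim/big_ind2 : _ => [|? ? ? ?|]; [exact: vle_refl|exact: vleD|exact: fg].
Qed.

Lemma positive_op_le (T : 'L(Z)) x y : positive_op T -> x <=v y -> T x <=v T y.
Proof.
move=> T0 /vsub_ge0 xy; apply/vsub_ge0.
by have := T0 _ xy; rewrite linearB.
Qed.

End OrderedSpace.

Lemma blin_sumE (R : realType) (V W : normedModType R) (I : Type) (s : seq I)
  (F : I -> blin V W) (x : V) : (\sum_(i <- s) F i) x = \sum_(i <- s) F i x.
Proof. by elim/big_rec2 : _ => // i y f _ <-. Qed.

Lemma op_leP (R : realType) (Z : orderedNormedModType R) (S T : 'L(Z)) :
  op_le S T <-> forall x, 0 <=v x -> S x <=v T x.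
Proof. by split=> ST x /ST /vsub_ge0. Qed.

Section BanachLattice.
Context {R : realType} {Y : banachLatticeType R}.
Implicit Types (u v y : Y) (f g w : dual Y).

Lemma vjoinl u v : u <=v vjoin u v.
Proof. by have [] := (vjoinP u v (vjoin u v)).1 (vle_refl _). Qed.

Lemma vjoinr u v : v <=v vjoin u v.
Proof. by have [] := (vjoinP u v (vjoin u v)).1 (vle_refl _). Qed.

Lemma vmeetl u v : vmeet u v <=v u.
Proof. by have [] := (vmeetP u v (vmeet u v)).1 (vle_refl _). Qed.

Lemma vmeetr u v : vmeet u v <=v v.
Proof. by have [] := (vmeetP u v (vmeet u v)).1 (vle_refl _). Qed.

(** This inequality allows the second term of a cover [y <= u + v] to be cut
    down to [v /\ y]. *)
Lemma vmeetDl_le u v y : 0 <=v u -> y <=v u + v -> y <=v u + vmeet v y.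
Proof.
move=> u0 yuv.
have : y - u <=v vmeet v y.
  apply/vmeetP; split.
    by have := vleD2r (- u) _ _ yuv; rewrite addrAC subrr add0r.
  by apply/vsub_ge0; rewrite opprB addrCA subrr addr0.
by move=> /(vleD2r u _ _); rewrite subrK addrC.
Qed.

Lemma vmod_ge0 y : 0 <=v vjoin y (- y).
Proof.
have := vleD (vjoinl y (- y)) (vjoinr y (- y)).
rewrite subrr -mulr2n -scaler_nat => h.
have := vleZ 2^-1 _ _ _ h.
by rewrite scaler0 scalerA mulVf ?scale1r//; apply; rewrite invr_ge0.
Qed.

Lemma vmod_id y : 0 <=v y -> vjoin y (- y) = y.
Proof.
move=> y0; apply: vle_anti; last exact: vjoinl.
apply/vjoinP; split; first exact: vle_refl.
suff Ny : - y <=v 0 by exact: (vle_trans _ _ _ Ny y0).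
by apply/vsub_ge0; rewrite sub0r opprK.
Qed.

Lemma norm_vmod y : `|vjoin y (- y)| <= `|y|.
Proof.
by apply: lattice_norm => /=; rewrite (vmod_id (vmod_ge0 y)); exact: vle_refl.
Qed.

Lemma norm_vle u v : 0 <=v u -> u <=v v -> `|u| <= `|v|.
Proof.
move=> u0 uv; apply: lattice_norm; rewrite /= !vmod_id//.
exact: (vle_trans _ _ _ u0 uv).
Qed.

Lemma dual_ge0P f : 0 <=v f <-> forall y, 0 <=v y -> 0 <= (f y : R).
Proof. by []. Qed.

Lemma positive_dual_le f u v : 0 <=v f -> u <=v v -> (f u : R) <= f v.
Proof.
move=> f0 /vsub_ge0 uv; have : 0 <= (f (v - u) : R) by exact: f0.
by rewrite linearB subr_ge0.
Qed.

(** A functional between 0 and [f] on the positive cone is monotone, so it is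
    controlled at [y] by the value of [f] at the modulus of [y]. Boundedness is
    thus a consequence of order, which is what makes the set of such functionals
    closed under pointwise limits. *)
Lemma dominated_functional_bound (phi : Y -> R) f : linear (phi : Y -> R^o) ->
  (forall y, 0 <=v y -> 0 <= phi y <= f y) ->
  forall y, `|phi y| <= `|f| * `|y|.
Proof.
move=> lphi phif.
pose L : {linear Y -> R^o} := HB.pack phi (GRing.isLinear.Build R Y R^o _ phi lphi).
have mono u v : u <=v v -> phi u <= phi v.
  move=> /vsub_ge0/phif/andP[+ _].
  by rewrite -[phi _]/(L (v - u)) linearB subr_ge0.
move=> y; set a := vjoin y (- y).
have ay : phi a <= `|f| * `|y|.
  have /andP[_ /le_trans ->//] := phif _ (vmod_ge0 y).
  rewrite (le_trans (ler_norm _))// (le_trans (opnormP f a))//.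
  by apply: ler_wpM2l; [exact: opnorm_ge0|exact: norm_vmod].
rewrite ler_norml lerNl -{1}[- phi y]/(- L y) -linearN.
by rewrite !(le_trans _ ay)//; apply: mono; [exact: vjoinl|exact: vjoinr].
Qed.

Lemma dominated_functional_dual (phi : Y -> R) f : linear (phi : Y -> R^o) ->
  (forall y, 0 <=v y -> 0 <= phi y <= f y) ->
  exists w : dual Y, (w : Y -> R) = phi.
Proof.
move=> lphi phif.
have bphi : (phi : Y -> R^o) \in @bounded_linear R Y R^o.
  apply/asboolP; split=> //; exists `|f|.
  exact: dominated_functional_bound.
by exists (BLin bphi).
Qed.

(** One half of the Riesz-Kantorovich formula: the value at [y] of the meet of [f]
    and [g] is the infimum of [f (y - v) + g v] over [v] between 0 and [y]. The
    functional [w] is obtained from the Hahn-Banach theorem applied to the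
    sublinear functional sending [y] to the infimum of [f u + g v] over the
    positive [u], [v] with [y <= u + v], and is below both [f] and [g] by
    construction. *)
Lemma dual_meet_lb f g y m : 0 <=v f -> 0 <=v g -> 0 <=v y ->
  (forall v, 0 <=v v -> v <=v y -> m <= (f (y - v) : R) + g v) ->
  exists w, [/\ 0 <=v w, w <=v f, w <=v g & m <= (w y : R)].
Proof.
move=> f0 g0 y0 mfg.
pose A : set (Y * R) := [set p | exists u v,
  [/\ 0 <=v u, 0 <=v v, p.1 <=v u + v & (f u : R) + g v <= p.2]].
have coneA : epi_cone A.
  split.
  - move=> x z r s [u [v [u0 v0 /= xuv r0]]] [u' [v' [u'0 v'0 /= zuv s0]]].
    exists (u + u'), (v + v'); split; try exact: vaddr_ge0.
      by rewrite addrACA; exact: vleD.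
    by rewrite !linearD /= addrACA lerD.
  - move=> t x r t0 [u [v [u0 v0 /= xuv r0]]]; exists (t *: u), (t *: v); split.
    + exact: vscale_ge0.
    + exact: vscale_ge0.
    + by rewrite -scalerDr; exact: vleZ.
    + by rewrite !linearZ /= -mulrDr ler_wpM2l.
  - move=> x; exists (f (vjoin x (- x)) : R), (vjoin x (- x)), 0; split => //=.
    + exact: vmod_ge0.
    + exact: vle_refl.
    + by rewrite addr0; exact: vjoinl.
    + by rewrite linear0 addr0.
  - move=> r [u [v [u0 v0 /= uv]]]; apply: le_trans.
    by apply: addr_ge0; [exact: f0|exact: g0].
have mA r : A (y, r) -> m <= r.
  move=> [u [v [u0 v0 /= yuv]]]; apply: le_trans.
  (* [v] may be large; it is replaced by its meet with [y]. *)
  have vy0 : 0 <=v vmeet v y by apply/vmeetP.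
  apply: (le_trans (mfg (vmeet v y) vy0 (vmeetr _ _))); apply: lerD.
    apply: positive_dual_le => //; apply/vsub_ge0; rewrite opprB addrA.
    by apply/vsub_ge0; exact: vmeetDl_le.
  by apply: positive_dual_le => //; exact: vmeetl.
have [phi [lphi phiA my]] := hahn_banach coneA mA.
have phif z : 0 <=v z -> phi z <= f z.
  move=> z0; apply: phiA; exists z, 0; split=> //=.
  - exact: vle_refl.
  - by rewrite addr0; exact: vle_refl.
  - by rewrite linear0 addr0.
have phig z : 0 <=v z -> phi z <= g z.
  move=> z0; apply: phiA; exists 0, z; split=> //=.
  - exact: vle_refl.
  - by rewrite add0r; exact: vle_refl.
  - by rewrite linear0 add0r.
have phi0 z : 0 <=v z -> 0 <= phi z.
  move=> z0.
  pose L : {linear Y -> R^o} := HB.pack phi (GRing.isLinear.Build R Y R^o _ phi lphi).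
  rewrite -oppr_le0 -[phi z]/(L z) -linearN; apply: phiA; exists 0, 0; split=> //=.
  - exact: vle_refl.
  - exact: vle_refl.
  - by rewrite addr0; apply/vsub_ge0; rewrite opprK add0r.
  - by rewrite !linear0 addr0.
have [z z0|w wphi] := dominated_functional_dual (f := f) lphi.
  by rewrite phi0// phif.
exists w; rewrite -[X in m <= X]/((w : Y -> R) y) wphi; split=> //.
- by apply/dual_ge0P => z z0; rewrite -[X in _ <= X]/((w : Y -> R) z) wphi phi0.
- by move=> z z0; rewrite -[X in X <= _]/((w : Y -> R) z) wphi phif.
- by move=> z z0; rewrite -[X in X <= _]/((w : Y -> R) z) wphi phig.
Qed.

End BanachLattice.

(** * AM-compact operators *)

Section AMCompact.
Context {R : realType}.

Lemma precompactD (V : normedModType R) (A B : set V) :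
  precompact A -> precompact B -> precompact [set a + b | a in A & b in B].
Proof.
rewrite !precompactE => cA cB.
pose add (p : V * V) := p.1 + p.2.
have cAB : compact [set add p | p in closure A `*` closure B].
  apply: continuous_compact; last exact: compact_setX.
  by apply: continuous_subspaceT => p; exact: add_continuous.
rewrite -precompactE.
apply: precompact_subset (compact_precompact (@norm_hausdorff _ _) cAB).
move=> _ [a Aa [b Bb <-]]; exists (a, b) => //.
by split; exact: subset_closure.
Qed.

Lemma precompactZ (V : normedModType R) (t : R) (A : set V) :
  precompact A -> precompact [set t *: a | a in A].
Proof.
rewrite precompactE => cA.
have ctA : compact [set t *: a | a in closure A].
  apply: continuous_compact => //.
  by apply: continuous_subspaceT => p; exact: scaler_continuous.
apply: precompact_subset (compact_precompact (@norm_hausdorff _ _) ctA).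
by move=> _ [a Aa <-]; exists a => //; exact: subset_closure.
Qed.

Context {Z : orderedNormedModType R}.
Implicit Types K L : 'L(Z).

Lemma AM_compact0 : AM_compact (0 : 'L(Z)).
Proof.
move=> a b; apply: (@precompact_subset _ _ [set 0]); first by move=> _ [z _ <-].
by apply: compact_precompact; [exact: norm_hausdorff|exact: compact_set1].
Qed.

Lemma AM_compactD K L : AM_compact K -> AM_compact L -> AM_compact (K + L).
Proof.
move=> cK cL a b; apply: precompact_subset (precompactD (cK a b) (cL a b)).
by move=> _ [z zab <-]; exists (K z); [exists z|exists (L z); [exists z|]].
Qed.

Lemma AM_compactZ (t : R) K : AM_compact K -> AM_compact (t *: K).
Proof.
move=> cK a b; apply: precompact_subset (precompactZ t (cK a b)).
by move=> _ [z zab <-]; exists (K z) => //; exists z.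
Qed.

End AMCompact.

(** * Weak-star compactness in the dual *)

(** Compactness as a finite selection principle. The neighbourhood of [x] on which
    [i] works is only asked to work inside [A]. *)
Lemma compact_finite_choice (T : topologicalType) (I : eqType) (A : set T)
    (D : set I) (good : I -> T -> Prop) : compact A ->
  (forall x, A x -> exists2 i, D i & \forall y \near x, A y -> good i y) ->
  exists s : seq I, (forall i, i \in s -> D i) /\
    forall x, A x -> exists2 i, i \in s & good i x.
Proof.
move=> /compact_near_coveringP ncA locA.
pose F := filter_from [set s : seq I | forall i, i \in s -> D i]
  (fun s => [set s' : seq I | {subset s <= s'}]).
have FF : Filter F.
  apply: filter_from_filter; first by exists [::].
  move=> s s' Ds Ds'; exists (s ++ s').
    by move=> i; rewrite mem_cat => /orP[/Ds|/Ds'].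
  by move=> u su; split=> i si; apply: su; rewrite mem_cat si ?orbT.
have /= := ncA _ F (fun s x => A x -> exists2 i, i \in s & good i x) FF.
case.
  move=> x Ax; have [i Di nxi] := locA _ Ax.
  exists ([set y | A y -> good i y], [set s : seq I | i \in s]) => /=.
    split=> //; exists [:: i]; first by move=> j; rewrite inE => /eqP ->.
    by move=> s /(_ i); rewrite inE eqxx; apply.
  by move=> [y s] /= [yi is_] Ay; exists i => //; exact: yi.
move=> s Ds sA; exists s; split=> // x Ax.
exact: (sA s _ x).
Qed.

Section FunctionalInterval.
Context {R : realType} {Y : banachLatticeType R}.
Variables (f : dual Y) (y0 : Y) (c : R).

(** The functionals are taken in the product topology, which is the weak-star
    topology; linearity and the order conditions are then closed conditions. *)
Definition functional_interval : set {ptws Y -> R} :=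
  [set phi | [/\ linear (phi : Y -> R^o),
    forall y, 0 <=v y -> 0 <= phi y <= f y & c <= phi y0]].

Lemma eval_continuous (y : Y) : continuous (fun phi : {ptws Y -> R} => phi y).
Proof. exact: (@proj_continuous Y (fun=> R) y). Qed.

Lemma closed_functional_interval : closed functional_interval.
Proof.
have -> : functional_interval =
    [set phi | forall p : R * Y * Y, phi (p.1.1 *: p.1.2 + p.2) -
        (p.1.1 * phi p.1.2 + phi p.2) = 0] `&`
    ([set phi | forall y, [set y | 0 <=v y] y -> 0 <= phi y] `&`
    ([set phi | forall y, [set y | 0 <=v y] y -> phi y <= f y] `&`
    [set phi | c <= phi y0])).
  apply/seteqP; split=> phi /=.
    move=> [lphi phif cphi]; split; first by move=> p; rewrite lphi subrr.
    by split; [|split] => // y /phif /andP[].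
  move=> [lphi [phi0 [phif cphi]]]; split=> //.
    by move=> a x y; apply/eqP; rewrite -subr_eq0; apply/eqP/(lphi (a, x, y)).
  by move=> y y0_; rewrite phi0// phif.
have ev := eval_continuous.
apply: closedI; last apply: closedI; last apply: closedI.
- rewrite (_ : mkset _ = \bigcap_(p in [set: R * Y * Y])
    [set phi : {ptws Y -> R} | phi (p.1.1 *: p.1.2 + p.2) -
        (p.1.1 * phi p.1.2 + phi p.2) = 0]); last first.
    by apply/seteqP; split=> phi h p; [move=> _; exact: h|exact: h].
  apply: closed_bigI => -[[a x] y] _ /=.
  apply: (@closed_comp _ _ (fun phi : {ptws Y -> R} =>
     phi (a *: x + y) - (a * phi x + phi y)) [set 0]); last exact: closed_eq.
  move=> phi _.
  have evphi z : (fun psi : {ptws Y -> R} => psi z) @ phi --> (phi z : R^o).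
    exact: (ev z phi).
  exact: (@cvgB _ R^o _ _ _ _ _ _ _ (evphi (a *: x + y))
    (@cvgD _ R^o _ _ _ _ _ _ _ (@cvgM _ _ _ _ _ _ _ _ (cvg_cst (a : R^o)) (evphi x)) (evphi y))).
- apply: closed_bigI => y _.
  apply: (@closed_comp _ _ (fun phi : {ptws Y -> R} => phi y) [set r | 0 <= r]);
    [by move=> phi _; exact: ev|exact: closed_ge].
- apply: closed_bigI => y _.
  apply: (@closed_comp _ _ (fun phi : {ptws Y -> R} => phi y)
    [set r : R | r <= f y]); [by move=> phi _; exact: ev|exact: closed_le].
- apply: (@closed_comp _ _ (fun phi : {ptws Y -> R} => phi y0) [set r | c <= r]);
    [by move=> phi _; exact: ev|exact: closed_ge].
Qed.

Lemma compact_functional_interval : compact functional_interval.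
Proof.
apply: (subclosed_compact closed_functional_interval).
  apply: (@tychonoff Y (fun=> R) (fun y => `[- (`|f| * `|y|), `|f| * `|y|]%classic)).
  by move=> y; exact: segment_compact.
move=> phi [lphi phif _] y /=.
by rewrite in_itv /= -ler_norml; exact: dominated_functional_bound.
Qed.

End FunctionalInterval.

Section LocalUniformity.
Context {R : realType} {Y : banachLatticeType R}.
Variables (f : dual Y) (y0 : Y) (c : R).
Local Notation B := (functional_interval f y0 c).

Lemma functional_interval_bound (phi : {ptws Y -> R}) (u v : Y) :
  B phi -> `|phi u - phi v| <= `|f| * `|u - v|.
Proof.
move=> [lphi phif _].
pose L : {linear Y -> R^o} := HB.pack phi (GRing.isLinear.Build R Y R^o _ phi lphi).
rewrite -[phi u]/(L u) -[phi v]/(L v) -linearB.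
exact: dominated_functional_bound.
Qed.

(** Equicontinuity of [B] turns pointwise convergence into uniform convergence on
    the relatively compact image under [K] of the order interval from 0 to
    [z]. *)
Lemma AM_compact_near (K : 'L(Y)) (w : {ptws Y -> R}) (z : Y) (d : R) :
  AM_compact K -> B w -> 0 < d ->
  \forall phi \near w, B phi ->
    forall v, 0 <=v v -> v <=v z -> `|phi (K v) - w (K v)| < d.
Proof.
move=> /(_ 0 z) + Bw d0; rewrite precompactE => /compact_near_coveringP ncQ.
have nQ := ncQ _ (nbhs w) (fun (phi : {ptws Y -> R}) q =>
  B phi -> `|phi q - w q| < d) (nbhs_filter w).
apply: filterS (nQ _); last first.
  move=> q _.
  have e0 : 0 < d / (4 * (`|f| + 1)).
    by rewrite divr_gt0// mulr_gt0// ltr_wpDl.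
  have fe : `|f| * (d / (4 * (`|f| + 1))) <= d / 4.
    rewrite mulrA ler_pdivrMr ?mulr_gt0 ?ltr_wpDl//.
    by move: d0; set F := `|f| => d0; clearbody F; lra.
  exists ([set q' | `|q - q'| < d / (4 * (`|f| + 1))],
          [set phi : {ptws Y -> R} | `|w q - phi q| < d / 2]) => /=.
    split; first exact: (@cvgr_dist_lt _ _ _ _ _ id q cvg_id).
    have d20 : 0 < d / 2 by rewrite divr_gt0.
    exact: (@cvgr_dist_lt R R^o _ (nbhs w) _ _ _ (@eval_continuous R Y q w)).
  move=> [q' phi] /= [qq' wphi] Bphi.
  have h1 := functional_interval_bound q q' Bphi.
  have h2 := functional_interval_bound q q' Bw.
  have h3 : `|f| * `|q - q'| <= d / 4.
    by apply: le_trans fe; rewrite ler_wpM2l// ltW.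
  move: h1 h2 wphi h3; set X := `|f| * _; set a := phi q; set a' := phi q'.
  set b := w q; set b' := w q'; rewrite !ler_norml !ltr_norml.
  move=> /andP[? ?] /andP[? ?] /andP[? ?] ?.
  by apply/andP; split; clearbody X a a' b b'; lra.
move=> phi Qphi Bphi v v0 vz.
by apply: Qphi => //; apply: subset_closure; exists v.
Qed.

(** On the order interval from 0 to [y0], replacing [S] by [K] at [w] and at [phi]
    costs [|f| * eps * |y0|] each time, and the error [e] costs [eps * |y0|]; the
    smallness of [eps] leaves a positive margin for the variation of
    [phi \o K]. *)
Lemma adjoint_lb_near (S K : 'L(Y)) (w e : dual Y) (eps : R) :
  AM_compact K -> B (w : Y -> R) -> 0 <=v y0 ->
  f <=v adjoint S w + e -> `|S - K| <= eps -> `|e| <= eps ->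
  eps * ((2 * `|f| + 1) * `|y0|) < c ->
  \forall phi \near ((w : Y -> R) : {ptws Y -> R}), B phi ->
    forall v, 0 <=v v -> v <=v y0 -> (f v : R) - c <= phi (S v).
Proof.
move=> cK Bw y00 fw Se ee epsc.
have := AM_compact_near y0 cK Bw (_ : 0 < c - eps * ((2 * `|f| + 1) * `|y0|)).
rewrite subr_gt0 => /(_ epsc); apply: filterS => phi near_phi Bphi v v0 vy.
have vy_norm : `|v| <= `|y0| by exact: norm_vle.
have eps0 : 0 <= eps by exact: le_trans ee.
have SKv : `|S v - K v| <= eps * `|y0|.
  rewrite -[_ - _]/((S - K) v) (le_trans (opnormP _ _))//.
  by apply: ler_pM => //; exact: opnorm_ge0.
have SK psi : B psi -> `|psi (S v) - psi (K v)| <= `|f| * (eps * `|y0|).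
  by move=> Bpsi; rewrite (le_trans (functional_interval_bound _ _ Bpsi))// ler_wpM2l.
have h1 : `|w (S v) - w (K v) : R| <= `|f| * (eps * `|y0|) := SK _ Bw.
have h2 := SK _ Bphi.
have h3 := near_phi Bphi v v0 vy.
have h4 : (f v : R) <= w (S v) + e v := fw v v0.
have h5 : `|e v : R| <= eps * `|y0|.
  by rewrite (le_trans (opnormP e v))// ler_pM//; exact: opnorm_ge0.
move: h1 h2 h3 h4 h5; set a := (w (S v) : R); set b := (w (K v) : R).
set A := phi (S v); set D := phi (K v); set F := (f v : R); set E := (e v : R).
rewrite !ler_norml ltr_norml => /andP[_ h1] /andP[h2 _] /andP[h3 _] h4 /andP[_ h5].
rewrite -/a -/b in h1 h3 *.
set p := eps * `|y0| in h1 h2 h5 *; set q := `|f| * p in h1 h2 *.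
have -> : c = (c - eps * ((2 * `|f| + 1) * `|y0|)) + 2 * q + p.
  by rewrite /q /p; ring.
move: h3; set g := c - _ => h3; clearbody g q p a b A D F E; lra.
Qed.

End LocalUniformity.

(** * Operators dominated by products *)

Section Domination.
Context {R : realType} {X : orderedNormedModType R}.
Implicit Types (C F : set 'L(X)) (A B S T : 'L(X)) (p : 'L(X) * 'L(X)).

Lemma super_right_commutant_id C : super_right_commutant C (blin_id X).
Proof.
split=> [x //|T CT]; apply/op_leP => x x0.
exact: vle_refl.
Qed.

Lemma super_right_commutant_comp C A B :
  super_right_commutant C A -> super_right_commutant C B ->
  super_right_commutant C (A \oL B).
Proof.
move=> [A0 cA] [B0 cB]; split=> [x x0|T CT]; first exact/A0/B0.
apply/op_leP => x x0; apply: (@vle_trans _ _ (A (T (B x)))).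
  exact: ((op_leP _ _).1 (cA T CT) _ (B0 _ x0)).
apply: positive_op_le => //; exact: ((op_leP _ _).1 (cB T CT) _ x0).
Qed.

Lemma super_right_commutantZ C (t : R) A : 0 <= t ->
  super_right_commutant C A -> super_right_commutant C (t *: A).
Proof.
move=> t0 [A0 cA]; split=> [x x0|T CT].
  by apply: vscale_ge0 => //; exact: A0.
apply/op_leP => x x0; rewrite -[_ x]/(T (t *: A x)) linearZ.
apply: vleZ => //; exact: ((op_leP _ _).1 (cA T CT) _ x0).
Qed.

Lemma op_expD F m n A B :
  op_exp F m A -> op_exp F n B -> op_exp F (m + n) (A \oL B).
Proof.
move=> + FB; elim: m A => [|m IH] A /=.
  move=> ->; rewrite add0n (_ : _ \oL B = B)//; exact: val_inj.
move=> [T FT [A' FA' <-]]; exists T => //; exists (A' \oL B); first exact: IH.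
exact: val_inj.
Qed.

Lemma op_expS F C n : F `<=` C -> op_exp F n `<=` op_exp C n.
Proof.
move=> FC; elim: n => [//|n IH] _ [T FT [A FA <-]].
by exists T; [exact: FC|exists A => //; exact: IH].
Qed.

Lemma finite_op_exp F n : finite_set F -> finite_set (op_exp F n).
Proof.
move=> finF; elim: n => [|n IH]; first exact: finite_set1.
exact: finite_image2.
Qed.

Lemma op_exp_finite_support C n B : op_exp C n B ->
  exists F, [/\ F `<=` C, finite_set F & op_exp F n B].
Proof.
elim: n B => [|n IH] B; first by move=> ->; exists set0; split=> //; exact: sub0set.
move=> [T CT [A /IH[F [FC finF FA]] <-]]; exists (T |` F); split.
- by move=> S [->//|/FC].
- by rewrite finite_setU; split => //; exact: finite_set1.
- exists T; [by left|exists A => //].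
  by apply: op_expS FA => S FS; right.
Qed.

(** The bound on the members of [D_ C], indexed by a sequence. The empty sequence
    is allowed, so 0 is dominated even when [C] is empty, and the dominated
    operators always form a convex cone. *)
Definition dominated C T := positive_op T /\ exists s : seq ('L(X) * 'L(X)),
  (forall p, p \in s -> super_right_commutant C p.1 /\ op_semigroup C p.2) /\
  op_le T (\sum_(p <- s) p.1 \oL p.2).

Lemma D_dominated C T : D_ C T -> dominated C T.
Proof.
move=> [T0 [k [_ [A [B [cA sB TAB]]]]]]; split=> //.
exists [seq (A i, B i) | i <- index_enum 'I_k]; split.
  by move=> p /mapP[i _ ->]; split; [exact: cA|exact: sB].
rewrite big_map; exact: TAB.
Qed.

Lemma dominated0 C : dominated C 0.
Proof.
split=> [x _|]; first exact: vle_refl.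
exists [::]; split=> //; apply/op_leP => x _.
by rewrite big_nil; exact: vle_refl.
Qed.

Lemma dominatedD C S T : dominated C S -> dominated C T -> dominated C (S + T).
Proof.
move=> [S0 [s [cs Ss]]] [T0 [t [ct Tt]]]; split=> [x x0|].
  by apply: vaddr_ge0; [exact: S0|exact: T0].
exists (s ++ t); split.
  by move=> p; rewrite mem_cat => /orP[/cs|/ct].
apply/op_leP => x x0; rewrite big_cat.
by apply: vleD; exact: (op_leP _ _).1.
Qed.

Lemma dominatedZ C (a : R) T : 0 <= a -> dominated C T -> dominated C (a *: T).
Proof.
move=> a0 [T0 [s [cs Ts]]]; split=> [x x0|].
  by apply: vscale_ge0 => //; exact: T0.
exists [seq (a *: p.1, p.2) | p <- s]; split.
  by move=> _ /mapP[p /cs[cp sp] ->]; split=> //; exact: super_right_commutantZ.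
apply/op_leP => x x0.
have -> : (\sum_(q <- [seq (a *: p.1, p.2) | p <- s]) q.1 \oL q.2) x =
    a *: (\sum_(p <- s) p.1 \oL p.2) x.
  by rewrite big_map !blin_sumE scaler_sumr.
by apply: vleZ => //; exact: (op_leP _ _).1.
Qed.

(** Quantitative data on a pair [(A, T)] standing for the product [A T]: a bound
    on the norm of [A], and a lower bound on the length of the word [T] in the
    fixed collection [F], to which quasinilpotence will be applied. *)
Definition controlled C F (M : R) (n : nat) p := [/\ super_right_commutant C p.1,
  `|p.1| <= M & exists2 N, (n <= N)%N & op_exp F N p.2].

Lemma controlled_mono C F F' (M M' : R) n p : F `<=` F' -> M <= M' ->
  controlled C F M n p -> controlled C F' M' n p.
Proof.
move=> FF' MM' [cp pM [N nN FN]]; split=> //; first exact: le_trans MM'.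
by exists N => //; exact: op_expS FN.
Qed.

Lemma controlled_seq C (s : seq ('L(X) * 'L(X))) :
  (forall p, p \in s -> super_right_commutant C p.1 /\ op_semigroup C p.2) ->
  exists F (M : R), [/\ F `<=` C, finite_set F, 0 <= M &
    forall p, p \in s -> controlled C F M 1 p].
Proof.
elim: s => [|p s IH] cs.
  by exists set0, 0; split=> //; exact: sub0set.
have [|F [M [FC finF M0 sM]]] := IH.
  by move=> q qs; apply: cs; rewrite inE qs orbT.
have [cp [N /= N1 CN]] := cs p (mem_head _ _).
have [F' [F'C finF' FN]] := op_exp_finite_support CN.
exists (F `|` F'), (Num.max M `|p.1|); split.
- by rewrite subUset.
- by rewrite finite_setU.
- by rewrite le_max M0.
move=> q; rewrite inE => /orP[/eqP ->|/sM]; last first.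
  by apply: controlled_mono; [exact: subsetUl|rewrite le_max lexx].
split=> //; first by rewrite le_max lexx orbT.
by exists N => //; apply: op_expS FN; exact: subsetUr.
Qed.

Definition controlled_by C F (M : R) (k : nat) T := positive_op T /\
  exists s, [/\ (size s <= k)%N, forall p, p \in s -> controlled C F M 1 p &
    op_le T (\sum_(p <- s) p.1 \oL p.2)].

(** Finitely many dominated operators involve only finitely many elements of [C],
    a bounded number of terms and factors of bounded norm. *)
Lemma dominated_controlled C (ts : seq 'L(X)) :
  (forall T, T \in ts -> dominated C T) ->
  exists F (M : R) k, [/\ F `<=` C, finite_set F, 0 <= M &
    forall T, T \in ts -> controlled_by C F M k T].
Proof.
elim: ts => [|T ts IH] dts.
  by exists set0, 0, 0%N; split=> //; exact: sub0set.
have [|F [M [k [FC finF M0 tsM]]]] := IH.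
  by move=> S Sts; apply: dts; rewrite inE Sts orbT.
have [T0 [s [cs Ts]]] := dts T (mem_head _ _).
have [F' [M' [F'C finF' M'0 sM']]] := controlled_seq cs.
exists (F `|` F'), (Num.max M M'), (maxn k (size s)); split.
- by rewrite subUset.
- by rewrite finite_setU.
- by rewrite le_max M0.
move=> S; rewrite inE => /orP[/eqP ->|/tsM[S0 [t [tk ct St]]]]; split=> //.
  exists s; split=> //; first exact: leq_maxr.
  move=> p /sM'; apply: controlled_mono; [exact: subsetUr|].
  by rewrite le_max lexx orbT.
exists t; split=> //; first by rewrite (leq_trans tk)// leq_maxl.
move=> p /ct; apply: controlled_mono; [exact: subsetUl|].
by rewrite le_max lexx.
Qed.

Variable C : set 'L(X).
Hypothesis C_ge0 : forall T, C T -> positive_op T.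

Lemma op_exp_ge0 n B : op_exp C n B -> positive_op B.
Proof.
elim: n B => [|n IH] B; first by move=> -> x.
by move=> [T CT [A /IH A0 <-]] x x0; exact: (C_ge0 CT (A0 _ x0)).
Qed.

(** The super right commutation passes from [C] to words in [C]; positivity of the
    letters is what lets the inequality be carried through each of them. *)
Lemma op_exp_super_commute n A B x : super_right_commutant C A ->
  op_exp C n B -> 0 <=v x -> B (A x) <=v A (B x).
Proof.
move=> [A0 cA]; elim: n B => [|n IH] B; first by move=> -> _; exact: vle_refl.
move=> [T CT [B' CB' <-]] x0; apply: (@vle_trans _ _ (T (A (B' x)))) => /=.
  by apply: positive_op_le; [exact: C_ge0|exact: IH].
exact: ((op_leP _ _).1 (cA T CT) _ (op_exp_ge0 CB' x0)).
Qed.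

(** Composing the bounds on the operators in [ts] gives products alternating
    between the commutant and words in [F]. Moving each new word to the right of
    the accumulated [u.1], which [op_exp_super_commute] permits, keeps the shape
    [A T], while norms multiply and lengths of words add. *)
Lemma iterates_dominated F (M : R) k (ts : seq 'L(X)) (z : nat -> X) n :
  F `<=` C -> 0 <= M -> (forall T, T \in ts -> controlled_by C F M k T) ->
  0 <=v z 0%N -> (forall n, exists2 T, T \in ts & z n.+1 <=v T (z n)) ->
  exists us, [/\ (size us <= k ^ n)%N,
    forall u, u \in us -> controlled C F (M ^+ n) n u &
    z n <=v \sum_(u <- us) u.1 (u.2 (z 0%N))].
Proof.
move=> FC M0 tsM z0 zT; elim: n => [|n [us [usn cus zus]]].
  exists [:: (blin_id X, blin_id X)]; split=> //; last first.
    by rewrite big_seq1; exact: vle_refl.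
  move=> u; rewrite inE => /eqP ->; split.
  - exact: super_right_commutant_id.
  - by rewrite expr0; exact: opnorm_le.
  - by exists 0%N.
have [T Tts zn] := zT n; have [T0 [s [sk cs Ts]]] := tsM _ Tts.
exists [seq (p.1 \oL u.1, p.2 \oL u.2) | p <- s, u <- us]; split.
- by rewrite size_allpairs expnS leq_mul.
- move=> w /allpairsP[[p u] /= [/cs[cp pM [N N1 FN]] /cus[cu uM [N' nN' FN']] ->]].
  split=> /=.
  + exact: super_right_commutant_comp.
  + apply: opnorm_le => x x1; rewrite exprS.
    apply: (le_trans (opnormP p.1 (u.1 x))); apply: ler_pM.
    * exact: opnorm_ge0.
    * exact: normr_ge0.
    * exact: pM.
    * by apply: le_trans uM; exact: opnorm_ub.
  + by exists (N + N')%N; [rewrite -add1n leq_add|exact: op_expD].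
apply: (vle_trans _ _ _ zn).
apply: (vle_trans _ _ _ (positive_op_le T0 zus)).
rewrite linear_sum big_allpairs_dep exchange_big /=.
apply: vle_sum => u /cus[cu _ [N nN FN]].
have uz0 : 0 <=v u.2 (z 0%N).
  by apply: op_exp_ge0 => //; exact: op_expS FN.
apply: (vle_trans _ _ _ ((op_leP _ _).1 Ts _ (cu.1 _ uz0))).
rewrite blin_sumE; apply: vle_sum => p /cs[[p0 _] _ [N' _ FN']] /=.
apply: positive_op_le => //; apply: op_exp_super_commute => //.
exact: op_expS FN'.
Qed.

End Domination.

(** * Decay along finitely quasinilpotent collections *)

Lemma finite_set_has_ubound (R : realType) (A : set R) :
  finite_set A -> has_ubound A.
Proof.
move=> /finite_seqP[s ->]; elim: s => [|a s [M sM]]; first by exists 0 => x.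
exists (Num.max a M) => x /=; rewrite inE => /orP[/eqP ->|/sM xM].
  by rewrite le_max lexx.
by rewrite le_max xM orbT.
Qed.

Section Decay.
Context {R : realType} {X : orderedNormedModType R}.
Implicit Types (C F : set 'L(X)).

(** The limit superior vanishes and the sequence is nonnegative, so it converges
    to 0; taking [N]-th powers gives geometric decay at every rate. *)
Lemma finitely_quasinilpotent_decay C F (x : X) (eta : R) :
  finitely_quasinilpotent_at C x -> F `<=` C -> finite_set F -> 0 < eta ->
  exists n0, forall N S, (n0 <= N)%N -> op_exp F N S -> `|S x| <= eta ^+ N.
Proof.
move=> qC FC finF eta0.
pose u n := set_norm [set T x | T in op_exp F n].
have cu : (((u n) `^ (n%:R)^-1)%:E @[n --> \oo] --> 0)%E.
  apply: limn_esup_le_cvg; first by rewrite (qC F FC finF).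
  by move=> n; rewrite lee_fin powR_ge0.
have [n1 _ un1] : \forall n \near \oo, (u n) `^ (n%:R)^-1 < eta.
  move/fine_cvgP : cu => [_ /cvgrPdist_lt/(_ _ eta0)].
  apply: filterS => n; rewrite sub0r normrN ger0_norm ?powR_ge0//.
exists (maxn n1 1) => N S; rewrite geq_max => /andP[n1N N0] FS.
have Su : `|S x| <= u N.
  apply: ub_le_sup; last by exists (S x) => //; exists S.
  by apply: finite_set_has_ubound; do 2!apply: finite_image; exact: finite_op_exp.
apply: (le_trans Su); have u0 : 0 <= u N by exact: le_trans Su.
have -> : u N = (u N `^ (N%:R)^-1) ^+ N.
  by rewrite -powR_mulrn ?powR_ge0// -powRrM mulVf ?powRr1// pnatr_eq0 -lt0n.
by rewrite lerXn2r// ?nnegrE ?powR_ge0// ltW//; exact: un1.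
Qed.

(** There are at most [k ^ n] terms of norm at most [(M * eta) ^ n] each, and [eta]
    is free. *)
Lemma iterates_vanish C (ts : seq 'L(X)) (z : nat -> X) (eps : R) :
  (forall T, C T -> positive_op T) -> finitely_quasinilpotent_at C (z 0%N) ->
  (forall T, T \in ts -> dominated C T) ->
  0 <=v z 0%N -> (forall n, exists2 T, T \in ts & z n.+1 <=v T (z n)) ->
  0 < eps -> exists n u, z n <=v u /\ `|u| < eps.
Proof.
move=> C0 qC dts z0 zT eps0.
have [F [M [k [FC finF M0 tsM]]]] := dominated_controlled dts.
pose a := k%:R * M; have a0 : 0 <= a by rewrite mulr_ge0.
(* This choice gives [k * M * eta <= 1 / 2]; the summand 1 keeps [eta] defined and
   at most 1 when [k * M] vanishes. *)
pose eta : R := (2 * (a + 1))^-1.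
have eta0 : 0 < eta by rewrite invr_gt0 mulr_gt0// ltr_wpDl.
have eta1 : eta <= 1 by rewrite invf_le1 ?mulr_gt0 ?ltr_wpDl//; lra.
have aeta : a * eta <= 2^-1.
  rewrite ler_pdivrMr ?mulr_gt0 ?ltr_wpDl//; lra.
have [n0 decay] := finitely_quasinilpotent_decay qC FC finF eta0.
have [n1 _ small] : \forall n \near \oo, (2^-1 : R) ^+ n < eps.
  have half1 : `|2^-1 : R| < 1 by rewrite ger0_norm//; lra.
  move/cvgrPdist_lt : (cvg_expr half1) => /(_ _ eps0); apply: filterS => n.
  by rewrite sub0r normrN ger0_norm// exprn_ge0.
pose n := maxn n0 n1.
have [us [usn cus zus]] := iterates_dominated C0 n FC M0 tsM z0 zT.
exists n, (\sum_(u <- us) u.1 (u.2 (z 0%N))); split=> //.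
apply: (@le_lt_trans _ _ ((2^-1) ^+ n)); last by apply: small; exact: leq_maxr.
apply: (@le_trans _ _ ((a * eta) ^+ n)); last first.
  by rewrite lerXn2r// ?nnegrE ?mulr_ge0// ltW.
apply: (le_trans (ler_norm_sum _ _ _)).
apply: (@le_trans _ _ (\sum_(u <- us) M ^+ n * eta ^+ n)).
  rewrite big_seq [leRHS]big_seq; apply: ler_sum => u /cus[_ uM [N nN FN]].
  apply: (le_trans (opnormP u.1 _)); apply: ler_pM => //; first exact: opnorm_ge0.
  apply: (le_trans (decay N _ _ FN)).
    by rewrite (leq_trans _ nN)// leq_maxl.
  by rewrite ler_wiXn2l// ltW.
rewrite big_const_seq count_predT iter_addr_0 -mulr_natl.
have -> : (a * eta) ^+ n = k%:R ^+ n * (M ^+ n * eta ^+ n).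
  by rewrite !exprMn mulrA.
apply: ler_wpM2r; first by rewrite mulr_ge0// exprn_ge0// ltW.
by rewrite -natrX ler_nat.
Qed.

End Decay.

(** * Separation by a positive functional *)

Section Alternative.
Context {R : realType} {Y : banachLatticeType R}.
Implicit Types (C : set 'L(dual Y)) (S K : 'L(Y)) (x z e : dual Y).

Lemma adjointD S K : adjoint (S + K) = adjoint S + adjoint K.
Proof.
apply: val_inj; apply/funext => z; apply: val_inj; apply/funext => y /=.
exact: (linearD (z : {linear Y -> R^o})).
Qed.

Lemma adjointZ (a : R) S : adjoint (a *: S) = a *: adjoint S.
Proof.
apply: val_inj; apply/funext => z; apply: val_inj; apply/funext => y /=.
exact: (linearZ_LR (z : {linear Y -> R^o})).
Qed.

Lemma adjoint0 : adjoint (0 : 'L(Y)) = 0.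
Proof. by rewrite -(scale0r (0 : 'L(Y))) adjointZ scale0r. Qed.

Lemma theta_ge (S : 'L(Y)) (m : R) :
  (forall K, AM_compact K -> m <= `|S - K|) -> m <= theta S.
Proof.
move=> mS; apply: lb_le_inf.
  by exists `|S - 0|; exists 0 => //; exact: AM_compact0.
by move=> _ [K cK <-]; exact: mS.
Qed.

Lemma preadjointK (T : 'L(dual Y)) : is_adjoint T -> adjoint (preadjoint T) = T.
Proof. by move=> [S TS]; rewrite /preadjoint; case: xgetP => [_ _ <-//|/(_ S)]. Qed.

(** If [x0] stays at distance [eps] from the vectors below [S^* x], where [S^*] is
    dominated and [S] is [eps]-close to an AM-compact operator, a positive
    functional separates. The cone [A] encodes the infimum of [|S - K| + |e|]
    over the decompositions [z <= S^* x + e]; this single sublinear functional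
    yields at once the boundedness ([S = 0], [e = z]), the positivity
    ([S = 0], [e = 0]) and the bound by [theta] ([e = 0]) of the
    separating [f]. *)
Lemma separation_alternative C x x0 (eps : R) : 0 <=v x -> 0 < eps ->
  (forall S K e, dominated C (adjoint S) -> AM_compact K ->
     `|S - K| < eps -> `|e| < eps -> ~ x0 <=v adjoint S x + e) ->
  exists f : dual (dual Y), [/\ positive_functional f, f <> 0 &
    forall T, E_ C T -> (f (T x) : R) <= theta (preadjoint T)].
Proof.
move=> x_ge0 eps0 far.
pose A : set (dual Y * R) := [set p | exists S K e,
  [/\ dominated C (adjoint S), AM_compact K, p.1 <=v adjoint S x + e &
      `|S - K| + `|e| <= p.2]].
have d0 : dominated C (adjoint (0 : 'L(Y))) by rewrite adjoint0; exact: dominated0.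
have coneA : epi_cone A.
  split.
  - move=> y z r s [S [K [e [dS cK /= ye er]]]] [S' [K' [e' [dS' cK' /= ze' er']]]].
    exists (S + S'), (K + K'), (e + e'); split.
    + by rewrite adjointD; exact: dominatedD.
    + exact: AM_compactD.
    + by rewrite adjointD /= addrACA; exact: vleD.
    + apply: le_trans (lerD er er'); rewrite addrACA /=; apply: lerD.
        by rewrite opprD addrACA; exact: ler_normD.
      exact: ler_normD.
  - move=> t z r t0 [S [K [e [dS cK /= ze er]]]].
    exists (t *: S), (t *: K), (t *: e); split.
    + by rewrite adjointZ; exact: dominatedZ.
    + exact: AM_compactZ.
    + by rewrite adjointZ -[_ x]/(t *: adjoint S x) -scalerDr; exact: vleZ.
    + by rewrite /= -scalerBr !normrZ (ger0_norm t0) -mulrDr ler_wpM2l.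
  - move=> z; exists `|z|, 0, 0, z; split=> //.
    + exact: AM_compact0.
    + by rewrite adjoint0 add0r; exact: vle_refl.
    + by rewrite subrr normr0 add0r.
  - by move=> r [S [K [e [_ _ _ /=]]]]; apply: le_trans; rewrite addr_ge0.
have mA r : A (x0, r) -> eps <= r.
  move=> [S [K [e [dS cK /= x0e er]]]]; rewrite leNgt; apply/negP => reps.
  apply: (far S K e dS cK _ _ x0e).
  - by apply: le_lt_trans reps; apply: le_trans er; rewrite lerDl.
  - by apply: le_lt_trans reps; apply: le_trans er; rewrite lerDr.
have [phi [lphi phiA phix0]] := hahn_banach coneA mA.
pose L : {linear dual Y -> R^o} :=
  HB.pack phi (GRing.isLinear.Build R (dual Y) R^o _ phi lphi).
have phi_norm z : phi z <= `|z|.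
  apply: phiA; exists 0, 0, z; split=> //.
  - exact: AM_compact0.
  - by rewrite adjoint0 add0r; exact: vle_refl.
  - by rewrite subrr normr0 add0r.
have bphi : (phi : dual Y -> R^o) \in @bounded_linear R (dual Y) R^o.
  apply/asboolP; split=> //; exists 1 => z; rewrite mul1r ler_norml phi_norm andbT.
  by rewrite lerNl -[phi z]/(L z) -linearN (le_trans (phi_norm _))// normrN.
exists (BLin bphi); split.
- move=> z z0 /=; rewrite -oppr_le0 -[phi z]/(L z) -linearN.
  apply: phiA; exists 0, 0, 0; split=> //.
  + exact: AM_compact0.
  + by rewrite adjoint0 addr0; apply/vsub_ge0; rewrite sub0r opprK.
  + by rewrite subrr !normr0 addr0.
- move=> f0; move: phix0; have -> : phi x0 = 0.
    by rewrite -[phi]/(blin_fun (BLin bphi)) f0.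
  by rewrite leNgt eps0.
- move=> T [DT aT]; apply: theta_ge => K cK; apply: phiA.
  exists (preadjoint T), K, 0; split=> //.
  + by rewrite preadjointK//; exact: D_dominated.
  + by rewrite preadjointK// addr0; exact: vle_refl.
  + by rewrite normr0 addr0.
Qed.

End Alternative.

(** * Iteration inside an order interval of the dual *)

Section Truncation.
Context {R : realType} {Y : banachLatticeType R}.
Implicit Types (S K : 'L(Y)) (w e : dual Y).

Lemma functional_interval_dual (f w : dual Y) (y0 : Y) (c : R) :
  functional_interval f y0 c (w : Y -> R) <->
  [/\ 0 <=v w, w <=v f & c <= (w y0 : R)].
Proof.
split=> [[_ wf cw]|[w0 wf cw]].
  split=> //; first by apply/dual_ge0P => y /wf/andP[].
  by move=> y /wf/andP[].
split=> //; first exact: blin_linear.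
by move=> y y_ge0; rewrite (dual_ge0P _).1// wf.
Qed.

(** The hypothesis on [S] makes [f (y0 - v) + w (S v)] at least
    [f y0 - c = c] for all [v] between 0 and [y0]; this number is the lower bound
    on the meet of [f] and [S^* w] at [y0]. *)
Lemma interval_step (f w : dual Y) (y0 : Y) (c : R) S :
  0 <=v f -> 0 <=v y0 -> positive_op (adjoint S) -> 0 <=v w ->
  (f y0 : R) = 2 * c ->
  (forall v, 0 <=v v -> v <=v y0 -> (f v : R) - c <= w (S v)) ->
  exists w', functional_interval f y0 c (w' : Y -> R) /\ w' <=v adjoint S w.
Proof.
move=> f0 y00 S0 w0 fy0 lbS.
have [v v0 vy|w' [w'0 w'f w'S cw']] := @dual_meet_lb _ _ f (adjoint S w) y0 c f0 (S0 _ w0) y00.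
  have := lbS v v0 vy; rewrite linearB /= fy0.
  by set a := (w (S v) : R); set b := (f v : R); clearbody a b; lra.
by exists w'; split=> //; apply/functional_interval_dual.
Qed.

End Truncation.

Theorem theorem10 (R : realType) (Y : banachLatticeType R)
    (C : set 'L(dual Y))
    (hC : forall T, C T -> positive_op T /\ is_adjoint T)
    (x0 : dual Y) (x0_ge0 : 0 <=v x0) (x0_neq0 : x0 <> 0)
    (hqn : finitely_quasinilpotent_at C x0) :
  exists (x : dual Y) (f : dual (dual Y)),
    [/\ 0 <=v x, x <> 0, positive_functional f, f <> 0 &
        forall T, E_ C T -> (f (T x) : R) <= theta (preadjoint T)].
Proof.
have [y0 [y00 x0y0]] : exists y0 : Y, 0 <=v y0 /\ 0 < (x0 y0 : R).
  apply: contrapT => no; apply: x0_neq0.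
  suff x0_le0 : x0 <=v 0 by exact: (vle_anti _ _ x0_le0 x0_ge0).
  move=> y y_ge0; apply: (_ : (x0 y : R) <= 0).
  by rewrite leNgt; apply/negP => x0y; apply: no; exists y.
pose c : R := x0 y0 / 2; have c0 : 0 < c by rewrite divr_gt0.
have x0y0E : (x0 y0 : R) = 2 * c by rewrite /c mulrC divfK.
pose B := functional_interval x0 y0 c.
pose a : R := (2 * `|x0| + 1) * `|y0|.
have a0 : 0 <= a by rewrite mulr_ge0// addr_ge0// mulr_ge0.
pose eps := c / (a + 1).
have eps0 : 0 < eps by rewrite divr_gt0// ltr_wpDl.
have epsa : eps * a < c.
  rewrite mulrAC ltr_pdivrMr ?ltr_wpDl//.
  by clearbody a c; lra.
(* From here on no pair [(x, f)] is assumed to exist, which excludes the first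
   branch of the alternative at every point of [B]. *)
apply: contrapT => none.
pose good S (phi : {ptws Y -> R}) := forall v, 0 <=v v -> v <=v y0 ->
  (x0 v : R) - c <= phi (S v).
have [s [Ds sB]] : exists s : seq 'L(Y),
    (forall S, S \in s -> dominated C (adjoint S)) /\
    forall phi, B phi -> exists2 S, S \in s & good S phi.
  have := @compact_finite_choice {ptws Y -> R} 'L(Y) B
    [set S | dominated C (adjoint S)] good (@compact_functional_interval _ _ x0 y0 c).
  apply=> phi Bphi.
  have [w wphi] : exists w : dual Y, (w : Y -> R) = phi.
    by case: Bphi => lphi phix0 _; exact: dominated_functional_dual lphi phix0.
  move: Bphi; rewrite -wphi => Bw.
  have [w0 wx0 cw] := (functional_interval_dual _ _ _ _).1 Bw.
  apply: contrapT => noS; apply: none.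
  have [S K e dS cK Se ee x0e|f [f0 fn0 fT]] :=
      @separation_alternative _ _ C w x0 eps w0 eps0.
    apply: noS; exists S => //.
    by apply: (adjoint_lb_near cK Bw y00 x0e _ _ epsa); exact: ltW.
  exists w, f; split=> // w00.
  by move: cw; rewrite w00 leNgt c0.
have step (w : {w : dual Y | B (w : Y -> R)}) :
    exists w' : {w : dual Y | B (w : Y -> R)},
    exists2 S, S \in s & sval w' <=v adjoint S (sval w).
  case: w => w Bw /=; have [S Ss gS] := sB _ Bw.
  have [S0 _] := Ds _ Ss.
  have [w0 _ _] := (functional_interval_dual _ _ _ _).1 Bw.
  have [w' [Bw' w'S]] := interval_step x0_ge0 y00 S0 w0 x0y0E gS.
  by exists (exist _ w' Bw'), S.
(* The sequence is kept inside the subtype of functionals in [B], so that the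
   choice of a successor applies again. *)
have [next nextP] := choice step.
have Bx0 : B (x0 : Y -> R).
  apply/functional_interval_dual; split.
  - exact: x0_ge0.
  - exact: vle_refl.
  - by rewrite x0y0E; clearbody c; lra.
pose z n := sval (iter n next (exist _ x0 Bx0)).
pose ts := map adjoint s.
have zT n : exists2 T, T \in ts & z n.+1 <=v T (z n).
  have [S Ss zS] := nextP (iter n next (exist _ x0 Bx0)).
  by exists (adjoint S) => //; exact: map_f.
have tsD T : T \in ts -> dominated C T by move=> /mapP[S Ss ->]; exact: Ds.
have d0 : 0 < c / (`|y0| + 1) by rewrite divr_gt0// ltr_wpDl.
have [n [u [znu u_small]]] := iterates_vanish (fun T CT => (hC T CT).1)
  (hqn : finitely_quasinilpotent_at C (z 0%N)) tsD x0_ge0 zT d0.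
have [_ _ cz] := (functional_interval_dual _ _ _ _).1 (svalP (iter n next (exist _ x0 Bx0))).
suff : (u y0 : R) < c by rewrite ltNge (le_trans cz (znu _ y00)).
apply: (le_lt_trans (ler_norm _)); apply: (le_lt_trans (opnormP u y0)).
have : opnorm u * `|y0| <= c / (`|y0| + 1) * `|y0|.
  by apply: ler_wpM2r => //; exact: ltW.
move=> /le_lt_trans; apply; rewrite mulrAC ltr_pdivrMr ?ltr_wpDl//.
have := normr_ge0 y0; set N := `|y0|; move=> N0; clearbody N c; lra.
Qed.
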